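(* The dimensional-splitting scheme described in the context (row sweeps (R1)--(R7), column sweeps (C1)--(C7), and the update (U)) ensures the boundedness of the phase variable. That is, for every solution of the scheme and every time level $n\in\{0,\dots,N-1\}$: for all $i,j$, if $|\phi_{i,j}^{n}|<1$, then $|\phi_{i,j}^{n+1}|<1$.
   Context: Parameters: real numbers $0<\varepsilon\ll1$ (interface width), $\kappa>0$ (contact line mobility), time step $\Delta t>0$, spatial steps $\Delta x>0$, $\Delta y>0$, prescribed contact angle $\theta_s\in[0,\pi]$, and positive integers $N_x,N_y,N$. A rectangular domain is divided into cells indexed by $i=1,\dots,N_x$, $j=1,\dots,N_y$; the row $j=1$ is adjacent to the substrate $\Gamma_w$. $\phi_{i,j}^n$ denotes the (approximate) cell average of the phase variable at time $n\Delta t$. Potential: $F$ is one of the following. (Logarithmic Flory--Huggins) $F(\chi)=F_{log}(\chi)-F_{log}(\beta)$ with $F_{log}(\chi)=\frac{\theta}{2}[(1+\chi)\ln(1+\chi)+(1-\chi)\ln(1-\chi)]+\frac12(1-\chi^2)$, $0<\theta<1$, where $\beta\in(0,1)$ is the positive root of $F_{log}'(\chi)=\frac{\theta}{2}\ln\frac{1+\chi}{1-\chi}-\chi=0$; (Polynomial) $F(\chi)=\frac14(1-\chi^2)^2$, with $\beta=1$. Put $c_F=\int_{-\beta}^{\beta}\sqrt{2F(\chi)}\,d\chi$ and $g(\chi)=\frac{\varepsilon c_F\cos\theta_s}{4\beta^3}(\chi^3-3\beta^2\chi)$. Notation: $\chi^+=\max\{\chi,0\}$, $\chi^-=\min\{\chi,0\}$,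 and the two-state upwind mobility is $M(\chi_1,\chi_2)=(1+\chi_1)^+(1-\chi_2)^+$. For an array $\psi$ with ghost values, $(\Delta\psi)_{i,j}=\frac{\psi_{i+1,j}-2\psi_{i,j}+\psi_{i-1,j}}{\Delta x^2}+\frac{\psi_{i,j+1}-2\psi_{i,j}+\psi_{i,j-1}}{\Delta y^2}$. Scheme: a solution consists of $\phi_{i,j}^n$ ($0\le n\le N$) together with, for each $n=0,\dots,N-1$, intermediate quantities satisfying the following. Step 1 (row sweeps). Set $\widetilde\phi_{i,j}^{n,0}=\phi_{i,j}^n$. For $q=1,\dots,N_y$ there are values $\widetilde\phi_{i,j}^{n,q},\widetilde\mu_{i,j}^{n,q}$, fluxes $\widetilde J^{n,q}$, velocities $\widetilde V^{n,q}$, scalars $\widetilde\xi^{n,q},\widetilde\eta^{n,q}$ and ghost values with: (R1) $\widetilde\phi_{i,j}^{n,q}-\widetilde\phi_{i,j}^{n,q-1}=-\frac{\Delta t}{\Delta x}(\widetilde J_{i+\frac12,j}^{n,q}-\widetilde J_{i-\frac12,j}^{n,q})$ if $j=q$, and $=0$ otherwise. (R2) $\widetilde J_{i+\frac12,j}^{n,q}=(\widetilde V_{i+\frac12,j}^{n,q})^+M(\widetilde\phi_{i,j}^{n,q},\widetilde\phi_{i+1,j}^{n,q})+(\widetilde V_{i+\frac12,j}^{n,q})^-M(\widetilde\phi_{i+1,j}^{n,q},\widetilde\phi_{i,j}^{n,q})$, with $\widetilde V_{i+\frac12,j}^{n,q}=-\frac1{\Delta x}(\widetilde\mu_{i+1,j}^{n,q}-\widetilde\mu_{i,j}^{n,q})$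 (faces between two cells; boundary faces are covered by (R3)). (R3) No flux: $\widetilde J_{\frac12,j}^{n,q}=\widetilde J_{N_x+\frac12,j}^{n,q}=0$ for all $j$. (R4) $\widetilde\mu_{i,j}^{n,q}=-\varepsilon^2(\Delta\widetilde\phi)_{i,j}^{n,q}+\widetilde\xi^{n,q}F'(\widetilde\phi_{i,j}^{n,q})$. (R5) $\sum_{i,j}(F(\widetilde\phi_{i,j}^{n,q})-F(\widetilde\phi_{i,j}^{n,q-1}))=\widetilde\xi^{n,q}\sum_{i,j}F'(\widetilde\phi_{i,j}^{n,q})(\widetilde\phi_{i,j}^{n,q}-\widetilde\phi_{i,j}^{n,q-1})$ (sums over all cells). (R6) $\sum_{i=1}^{N_x}(g(\widetilde\phi_{i,1}^{n,q})-g(\widetilde\phi_{i,1}^{n,q-1}))=\widetilde\eta^{n,q}\sum_{i=1}^{N_x}g'(\widetilde\phi_{i,1}^{n,q})(\widetilde\phi_{i,1}^{n,q}-\widetilde\phi_{i,1}^{n,q-1})$. (R7) Ghost values: $\widetilde\phi_{0,j}^{n,q}=\widetilde\phi_{1,j}^{n,q}$, $\widetilde\phi_{N_x+1,j}^{n,q}=\widetilde\phi_{N_x,j}^{n,q}$, $\widetilde\phi_{i,N_y+1}^{n,q}=\widetilde\phi_{i,N_y}^{n,q}$, $\widetilde\phi_{i,0}^{n,q}=\widetilde\phi_{i,1}^{n,q}-\frac{\Delta y}{\varepsilon^2}\left(\frac{\widetilde\phi_{i,1}^{n,q}-\widetilde\phi_{i,1}^{n,q-1}}{\kappa\Delta t}+\widetilde\eta^{n,q}g'(\widetilde\phi_{i,1}^{n,q})\right)$.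 (These implement the dynamic contact line condition $\frac{\widetilde\phi_{i,1}^{n,q}-\widetilde\phi_{i,1}^{n,q-1}}{\kappa\Delta t}=\varepsilon^2\frac{\widetilde\phi_{i,1}^{n,q}-\widetilde\phi_{i,0}^{n,q}}{\Delta y}-\widetilde\eta^{n,q}g'(\widetilde\phi_{i,1}^{n,q})$ for $q=1$; for $q\ne1$ the left-hand side is $0$.) Step 2 (column sweeps). Set $\widehat\phi_{i,j}^{n,0}=\widetilde\phi_{i,j}^{n,N_y}$. For $p=1,\dots,N_x$ there are values $\widehat\phi_{i,j}^{n,p},\widehat\mu_{i,j}^{n,p}$, fluxes $\widehat J^{n,p}$, velocities $\widehat V^{n,p}$, scalars $\widehat\xi^{n,p},\widehat\eta^{n,p}$ and ghost values with: (C1) $\widehat\phi_{i,j}^{n,p}-\widehat\phi_{i,j}^{n,p-1}=-\frac{\Delta t}{\Delta y}(\widehat J_{i,j+\frac12}^{n,p}-\widehat J_{i,j-\frac12}^{n,p})$ if $i=p$, and $=0$ otherwise. (C2) $\widehat J_{i,j+\frac12}^{n,p}=(\widehat V_{i,j+\frac12}^{n,p})^+M(\widehat\phi_{i,j}^{n,p},\widehat\phi_{i,j+1}^{n,p})+(\widehat V_{i,j+\frac12}^{n,p})^-M(\widehat\phi_{i,j+1}^{n,p},\widehat\phi_{i,j}^{n,p})$, with $\widehat V_{i,j+\frac12}^{n,p}=-\frac1{\Delta y}(\widehat\mu_{i,j+1}^{n,p}-\widehat\mu_{i,j}^{n,p})$ (faces between two cells; boundary faces are covered by (C3)). (C3)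 No flux: $\widehat J_{i,\frac12}^{n,p}=\widehat J_{i,N_y+\frac12}^{n,p}=0$ for all $i$. (C4) $\widehat\mu_{i,j}^{n,p}=-\varepsilon^2(\Delta\widehat\phi)_{i,j}^{n,p}+\widehat\xi^{n,p}F'(\widehat\phi_{i,j}^{n,p})$. (C5) $\sum_{i,j}(F(\widehat\phi_{i,j}^{n,p})-F(\widehat\phi_{i,j}^{n,p-1}))=\widehat\xi^{n,p}\sum_{i,j}F'(\widehat\phi_{i,j}^{n,p})(\widehat\phi_{i,j}^{n,p}-\widehat\phi_{i,j}^{n,p-1})$ (sums over all cells). (C6) $\sum_{i=1}^{N_x}(g(\widehat\phi_{i,1}^{n,p})-g(\widehat\phi_{i,1}^{n,p-1}))=\widehat\eta^{n,p}\sum_{i=1}^{N_x}g'(\widehat\phi_{i,1}^{n,p})(\widehat\phi_{i,1}^{n,p}-\widehat\phi_{i,1}^{n,p-1})$. (C7) Ghost values: $\widehat\phi_{0,j}^{n,p}=\widehat\phi_{1,j}^{n,p}$, $\widehat\phi_{N_x+1,j}^{n,p}=\widehat\phi_{N_x,j}^{n,p}$, $\widehat\phi_{i,N_y+1}^{n,p}=\widehat\phi_{i,N_y}^{n,p}$, $\widehat\phi_{i,0}^{n,p}=\widehat\phi_{i,1}^{n,p}-\frac{\Delta y}{\varepsilon^2}\left(\frac{\widehat\phi_{i,1}^{n,p}-\widehat\phi_{i,1}^{n,p-1}}{\kappa\Delta t}+\widehat\eta^{n,p}g'(\widehat\phi_{i,1}^{n,p})\right)$. (These implement the dynamic contact line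 condition $\frac{\widehat\phi_{i,1}^{n,p}-\widehat\phi_{i,1}^{n,p-1}}{\kappa\Delta t}=\varepsilon^2\frac{\widehat\phi_{i,1}^{n,p}-\widehat\phi_{i,0}^{n,p}}{\Delta y}-\widehat\eta^{n,p}g'(\widehat\phi_{i,1}^{n,p})$ for $i=p$; for $i\ne p$ the left-hand side is $0$.) (U) $\phi_{i,j}^{n+1}=\widehat\phi_{i,j}^{n,N_x}$, and $\xi^{n+1}=\frac{\sum_{q=1}^{N_y}\widetilde\xi^{n,q}+\sum_{p=1}^{N_x}\widehat\xi^{n,p}}{N_y+N_x}$, $\eta^{n+1}=\frac{\sum_{q=1}^{N_y}\widetilde\eta^{n,q}+\sum_{p=1}^{N_x}\widehat\eta^{n,p}}{N_y+N_x}$. *)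

(* Defs.v *)
From Stdlib Require Import Reals.
From Coquelicot Require Import Coquelicot.
Open Scope R_scope.

(* [FloryHuggins theta beta] carries the positive root [beta] of the derivative
   of the logarithmic potential as data; [potential_ok] pins it down. *)
Inductive potential : Type :=
| FloryHuggins (theta beta : R)
| Polynomial.

(* Stdlib's [ln] is total, with [ln x = 0] for [x <= 0].  Hence
   [(1 + x) * ln (1 + x)] has its usual value 0 at [x = -1], and [F_log] is also
   given a (conventional) value for [1 < Rabs x]. *)
Definition F_log (theta x : R) : R :=
  theta / 2 * ((1 + x) * ln (1 + x) + (1 - x) * ln (1 - x)) + / 2 * (1 - x ^ 2).

Definition potential_ok (pot : potential) : Prop :=
  match pot with
  | FloryHuggins theta beta =>
      0 < theta < 1 /\ 0 < beta < 1 /\ Derive (F_log theta) beta = 0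
  | Polynomial => True
  end.

Definition pot_beta (pot : potential) : R :=
  match pot with
  | FloryHuggins _ beta => beta
  | Polynomial => 1
  end.

Definition pot_F (pot : potential) (x : R) : R :=
  match pot with
  | FloryHuggins theta beta => F_log theta x - F_log theta beta
  | Polynomial => / 4 * (1 - x ^ 2) ^ 2
  end.

Definition c_F (pot : potential) : R :=
  RInt (fun x => sqrt (2 * pot_F pot x)) (- pot_beta pot) (pot_beta pot).

Record params : Type := Params {
  eps : R;
  kappa : R;
  dt : R;
  dx : R;
  dy : R;
  theta_s : R;
  pot : potential;
  Nx : nat;
  Ny : nat;
  Nt : nat
}.

Record admissible (P : params) : Prop := Admissible {
  eps_range : 0 < eps P < 1;
  kappa_pos : 0 < kappa P;
  dt_pos : 0 < dt P;
  dx_pos : 0 < dx P;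
  dy_pos : 0 < dy P;
  theta_s_range : 0 <= theta_s P <= PI;
  pot_valid : potential_ok (pot P);
  Nx_pos : (1 <= Nx P)%nat;
  Ny_pos : (1 <= Ny P)%nat;
  Nt_pos : (1 <= Nt P)%nat
}.

(* The scheme does not presuppose [Rabs x <= 1] for the arguments of [F] and [F'];
   outside that range the logarithmic case takes the values given by the total
   [ln] and [Derive]. *)
Definition F (P : params) : R -> R := pot_F (pot P).
Definition F' (P : params) : R -> R := Derive (F P).

Definition g (P : params) (x : R) : R :=
  let beta := pot_beta (pot P) in
  eps P * c_F (pot P) * cos (theta_s P) / (4 * beta ^ 3)
  * (x ^ 3 - 3 * beta ^ 2 * x).
Definition g' (P : params) : R -> R := Derive (g P).

Definition pos_part (x : R) : R := Rmax x 0.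
Definition neg_part (x : R) : R := Rmin x 0.

Definition mobility (x1 x2 : R) : R := pos_part (1 + x1) * pos_part (1 - x2).

Definition upwind_flux (v left right : R) : R :=
  pos_part v * mobility left right + neg_part v * mobility right left.

(* Cells have indices [1 <= i <= Nx], [1 <= j <= Ny]; the indices [0], [Nx + 1]
   and [Ny + 1] hold the ghost values. *)
Definition array : Type := nat -> nat -> R.

Definition in_cols (P : params) (i : nat) : Prop := (1 <= i <= Nx P)%nat.
Definition in_rows (P : params) (j : nat) : Prop := (1 <= j <= Ny P)%nat.

Definition laplacian (P : params) (psi : array) (i j : nat) : R :=
  (psi (i + 1)%nat j - 2 * psi i j + psi (i - 1)%nat j) / dx P ^ 2
  + (psi i (j + 1)%nat - 2 * psi i j + psi i (j - 1)%nat) / dy P ^ 2.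

Definition sum_cols (P : params) (f : nat -> R) : R := sum_n_m f 1 (Nx P).
Definition sum_rows (P : params) (f : nat -> R) : R := sum_n_m f 1 (Ny P).
Definition sum_cells (P : params) (f : array) : R :=
  sum_cols P (fun i => sum_rows P (fun j => f i j)).

(* In a row sweep, [s_J s i j] and [s_V s i j] live on the face [(i + 1/2, j)];
   in a column sweep they live on the face [(i, j + 1/2)]. *)
Record stage : Type := Stage {
  s_phi : array;
  s_mu : array;
  s_J : array;
  s_V : array;
  s_xi : R;
  s_eta : R
}.

Record stage_common (P : params) (old : array) (s : stage) : Prop := StageCommon {
  chemical_potential : forall i j, in_cols P i -> in_rows P j ->
    s_mu s i j = - eps P ^ 2 * laplacian P (s_phi s) i j
                 + s_xi s * F' P (s_phi s i j);
  bulk_multiplier :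
    sum_cells P (fun i j => F P (s_phi s i j) - F P (old i j))
    = s_xi s * sum_cells P (fun i j => F' P (s_phi s i j) * (s_phi s i j - old i j));
  wall_multiplier :
    sum_cols P (fun i => g P (s_phi s i 1%nat) - g P (old i 1%nat))
    = s_eta s * sum_cols P (fun i =>
        g' P (s_phi s i 1%nat) * (s_phi s i 1%nat - old i 1%nat));
  ghost_left : forall j, in_rows P j -> s_phi s 0%nat j = s_phi s 1%nat j;
  ghost_right : forall j, in_rows P j ->
    s_phi s (Nx P + 1)%nat j = s_phi s (Nx P) j;
  ghost_top : forall i, in_cols P i ->
    s_phi s i (Ny P + 1)%nat = s_phi s i (Ny P);
  (* The dynamic contact line condition at the wall [j = 1/2], solved for the
     ghost value below it. *)
  ghost_wall : forall i, in_cols P i ->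
    s_phi s i 0%nat
    = s_phi s i 1%nat
      - dy P / eps P ^ 2
        * ((s_phi s i 1%nat - old i 1%nat) / (kappa P * dt P)
           + s_eta s * g' P (s_phi s i 1%nat))
}.

Record row_stage (P : params) (q : nat) (old : array) (s : stage) : Prop := RowStage {
  row_update : forall i, in_cols P i -> in_rows P q ->
    s_phi s i q - old i q = - (dt P / dx P) * (s_J s i q - s_J s (i - 1)%nat q);
  row_frozen : forall i j, in_cols P i -> in_rows P j -> j <> q ->
    s_phi s i j - old i j = 0;
  row_velocity : forall i j, (1 <= i < Nx P)%nat -> in_rows P j ->
    s_V s i j = - (/ dx P) * (s_mu s (i + 1)%nat j - s_mu s i j);
  row_flux : forall i j, (1 <= i < Nx P)%nat -> in_rows P j ->
    s_J s i j = upwind_flux (s_V s i j) (s_phi s i j) (s_phi s (i + 1)%nat j);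
  row_no_flux : forall j, in_rows P j -> s_J s 0%nat j = 0 /\ s_J s (Nx P) j = 0;
  row_common : stage_common P old s
}.

Record col_stage (P : params) (p : nat) (old : array) (s : stage) : Prop := ColStage {
  col_update : forall j, in_cols P p -> in_rows P j ->
    s_phi s p j - old p j = - (dt P / dy P) * (s_J s p j - s_J s p (j - 1)%nat);
  col_frozen : forall i j, in_cols P i -> in_rows P j -> i <> p ->
    s_phi s i j - old i j = 0;
  col_velocity : forall i j, in_cols P i -> (1 <= j < Ny P)%nat ->
    s_V s i j = - (/ dy P) * (s_mu s i (j + 1)%nat - s_mu s i j);
  col_flux : forall i j, in_cols P i -> (1 <= j < Ny P)%nat ->
    s_J s i j = upwind_flux (s_V s i j) (s_phi s i j) (s_phi s i (j + 1)%nat);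
  col_no_flux : forall i, in_cols P i -> s_J s i 0%nat = 0 /\ s_J s i (Ny P) = 0;
  col_common : stage_common P old s
}.

(* [row n q] and [col n p] are the stages of the sweeps of time step [n]; of the
   stages [row n 0] and [col n 0] only the phase on the cells is meaningful. *)
Record scheme_data : Type := SchemeData {
  phi : nat -> array;
  row : nat -> nat -> stage;
  col : nat -> nat -> stage;
  xi : nat -> R;
  eta : nat -> R
}.

Record time_step (P : params) (D : scheme_data) (n : nat) : Prop := TimeStep {
  row_start : forall i j, in_cols P i -> in_rows P j ->
    s_phi (row D n 0%nat) i j = phi D n i j;
  row_sweep : forall q, in_rows P q ->
    row_stage P q (s_phi (row D n (q - 1)%nat)) (row D n q);
  col_start : forall i j, in_cols P i -> in_rows P j ->
    s_phi (col D n 0%nat) i j = s_phi (row D n (Ny P)) i j;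
  col_sweep : forall p, in_cols P p ->
    col_stage P p (s_phi (col D n (p - 1)%nat)) (col D n p);
  phi_next : forall i j, in_cols P i -> in_rows P j ->
    phi D (n + 1)%nat i j = s_phi (col D n (Nx P)) i j;
  xi_next : xi D (n + 1)%nat
    = (sum_rows P (fun q => s_xi (row D n q)) + sum_cols P (fun p => s_xi (col D n p)))
      / (INR (Ny P) + INR (Nx P));
  eta_next : eta D (n + 1)%nat
    = (sum_rows P (fun q => s_eta (row D n q)) + sum_cols P (fun p => s_eta (col D n p)))
      / (INR (Ny P) + INR (Nx P))
}.

Definition is_solution (P : params) (D : scheme_data) : Prop :=
  forall n, (n < Nt P)%nat -> time_step P D n.

(* Main.v *)
Require Import Defs.
From Stdlib Require Import Reals Lra Lia.
From Coquelicot Require Import Coquelicot.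
Open Scope R_scope.

(** The bound is a cell-by-cell consequence of the degenerate upwind mobility,
    evaluated implicitly.  The flux across a face carries the factor
    [(1 + phi)^+] of the cell it leaves and [(1 - phi)^+] of the cell it enters.
    Hence a cell whose new value is at most [-1] cannot lose mass, and one whose
    new value is at least [1] cannot gain mass, whatever the velocities and the
    neighbouring values are ([upwind_flux_nonpos], [upwind_flux_nonneg]).  If the
    new value were at most [-1], the conservative update would therefore make it
    at least the old value, which exceeds [-1]; the case of [1] is symmetric
    ([conservative_update_bound]).  Each sweep stage either leaves a cell
    unchanged or performs such an update on it, so the bound propagates through
    all stages of a time step. *)

Lemma mobility_nonneg x1 x2 : 0 <= mobility x1 x2.
Proof. apply Rmult_le_pos; apply Rmax_r. Qed.

(** The mobility degenerates where it must: it lets no mass out of a cell already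
    at or below [-1] and none into a cell already at or above [1]. *)
Lemma mobility_eq0 x1 x2 : x1 <= -1 \/ 1 <= x2 -> mobility x1 x2 = 0.
Proof.
  unfold mobility, pos_part; intros [H | H].
  - rewrite (Rmax_right (1 + x1)) by lra; ring.
  - rewrite (Rmax_right (1 - x2)) by lra; ring.
Qed.

Lemma upwind_flux_nonpos v l r : l <= -1 \/ 1 <= r -> upwind_flux v l r <= 0.
Proof.
  intros H; unfold upwind_flux, neg_part; rewrite (mobility_eq0 l r H).
  pose proof (mobility_nonneg r l); pose proof (Rmin_r v 0); nra.
Qed.

Lemma upwind_flux_nonneg v l r : r <= -1 \/ 1 <= l -> 0 <= upwind_flux v l r.
Proof.
  intros H; unfold upwind_flux, pos_part; rewrite (mobility_eq0 r l H).
  pose proof (mobility_nonneg l r); pose proof (Rmax_r v 0); nra.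
Qed.

Lemma upwind_flux0 l r : upwind_flux 0 l r = 0.
Proof.
  unfold upwind_flux, pos_part, neg_part.
  rewrite Rmax_left, Rmin_left by lra; ring.
Qed.

(** The fluxes are existentially quantified over velocities and neighbouring
    values so that a no-flux boundary face, which has velocity [0] and no
    neighbour, is covered together with the interior faces. *)
Lemma conservative_update_bound c old new Jl Jr :
  0 < c ->
  (exists v l, Jl = upwind_flux v l new) ->
  (exists v r, Jr = upwind_flux v new r) ->
  new - old = - c * (Jr - Jl) ->
  Rabs old < 1 -> Rabs new < 1.
Proof.
  intros Hc [vl [l El]] [vr [r Er]] Hupd Hold.
  apply Rabs_def2 in Hold as [Hold1 Hold2].
  apply Rabs_def1; apply Rnot_le_lt; intros Hnew.
  - pose proof (upwind_flux_nonpos vl l new (or_intror Hnew)).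
    pose proof (upwind_flux_nonneg vr new r (or_intror Hnew)).
    nra.
  - pose proof (upwind_flux_nonneg vl l new (or_introl Hnew)).
    pose proof (upwind_flux_nonpos vr new r (or_introl Hnew)).
    nra.
Qed.

Lemma row_stage_bound P q old s i j :
  admissible P -> row_stage P q old s -> in_cols P i -> in_rows P j ->
  Rabs (old i j) < 1 -> Rabs (s_phi s i j) < 1.
Proof.
  intros HP Hs Hi Hj Hold.
  destruct (Nat.eq_dec j q) as [<- | Hne].
  2: { pose proof (row_frozen _ _ _ _ Hs i j Hi Hj Hne).
       replace (s_phi s i j) with (old i j) by lra; exact Hold. }
  destruct (row_no_flux _ _ _ _ Hs j Hj) as [J0 JN].
  unfold in_cols in Hi.
  apply (conservative_update_bound (dt P / dx P) (old i j) _
           (s_J s (i - 1)%nat j) (s_J s i j)).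
  - apply Rdiv_lt_0_compat; [exact (dt_pos P HP) | exact (dx_pos P HP)].
  - destruct (Nat.eq_dec i 1) as [-> | H1].
    + exists 0, 0; rewrite upwind_flux0; exact J0.
    + exists (s_V s (i - 1)%nat j), (s_phi s (i - 1)%nat j).
      rewrite (row_flux _ _ _ _ Hs (i - 1)%nat j) by (assumption || lia).
      now replace (i - 1 + 1)%nat with i by lia.
  - destruct (Nat.eq_dec i (Nx P)) as [-> | HN].
    + exists 0, 0; rewrite upwind_flux0; exact JN.
    + exists (s_V s i j), (s_phi s (i + 1)%nat j).
      apply (row_flux _ _ _ _ Hs); [lia | exact Hj].
  - exact (row_update _ _ _ _ Hs i Hi Hj).
  - exact Hold.
Qed.

Lemma col_stage_bound P p old s i j :
  admissible P -> col_stage P p old s -> in_cols P i -> in_rows P j ->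
  Rabs (old i j) < 1 -> Rabs (s_phi s i j) < 1.
Proof.
  intros HP Hs Hi Hj Hold.
  destruct (Nat.eq_dec i p) as [<- | Hne].
  2: { pose proof (col_frozen _ _ _ _ Hs i j Hi Hj Hne).
       replace (s_phi s i j) with (old i j) by lra; exact Hold. }
  destruct (col_no_flux _ _ _ _ Hs i Hi) as [J0 JN].
  unfold in_rows in Hj.
  apply (conservative_update_bound (dt P / dy P) (old i j) _
           (s_J s i (j - 1)%nat) (s_J s i j)).
  - apply Rdiv_lt_0_compat; [exact (dt_pos P HP) | exact (dy_pos P HP)].
  - destruct (Nat.eq_dec j 1) as [-> | H1].
    + exists 0, 0; rewrite upwind_flux0; exact J0.
    + exists (s_V s i (j - 1)%nat), (s_phi s i (j - 1)%nat).
      rewrite (col_flux _ _ _ _ Hs i (j - 1)%nat) by (assumption || lia).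
      now replace (j - 1 + 1)%nat with j by lia.
  - destruct (Nat.eq_dec j (Ny P)) as [-> | HN].
    + exists 0, 0; rewrite upwind_flux0; exact JN.
    + exists (s_V s i j), (s_phi s i (j + 1)%nat).
      apply (col_flux _ _ _ _ Hs); [exact Hi | lia].
  - exact (col_update _ _ _ _ Hs j Hi Hj).
  - exact Hold.
Qed.

Lemma sweep_bound (u : nat -> array) (m i j : nat) :
  (forall k, (1 <= k <= m)%nat ->
     Rabs (u (k - 1)%nat i j) < 1 -> Rabs (u k i j) < 1) ->
  Rabs (u 0%nat i j) < 1 -> Rabs (u m i j) < 1.
Proof.
  induction m as [| m IH]; intros Hstep H0; [exact H0 |].
  apply Hstep; [lia |].
  replace (S m - 1)%nat with m by lia.
  apply IH; [| exact H0].
  intros k Hk; apply Hstep; lia.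
Qed.

Theorem theorem4 :
  forall (P : params) (D : scheme_data),
    admissible P ->
    is_solution P D ->
    forall n : nat, (n < Nt P)%nat ->
    forall i j : nat, in_cols P i -> in_rows P j ->
      Rabs (phi D n i j) < 1 ->
      Rabs (phi D (n + 1)%nat i j) < 1.
Proof.
  intros P D HP HD n Hn i j Hi Hj Hphi.
  pose proof (HD n Hn) as T.
  rewrite (phi_next _ _ _ T i j Hi Hj).
  apply (sweep_bound (fun p => s_phi (col D n p)) (Nx P)).
  { intros p Hp; apply (col_stage_bound P p); auto.
    exact (col_sweep _ _ _ T p Hp). }
  rewrite (col_start _ _ _ T i j Hi Hj).
  apply (sweep_bound (fun q => s_phi (row D n q)) (Ny P)).
  { intros q Hq; apply (row_stage_bound P q); auto.
    exact (row_sweep _ _ _ T q Hq). }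
  rewrite (row_start _ _ _ T i j Hi Hj).
  exact Hphi.
Qed.
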